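(* There exists a finite simple undirected graph $G$ whose weak-factor series does not terminate, i.e. such that in the weak-factor series $(G_i)_{i\ge 1}$ generated by $G$, the graph $G_i$ is defined for every $i\ge 1$ and the weak-factor factorisation of every $G_i$ is effective.
   Context: All graphs are finite, undirected and simple. A $k$-partite graph $G=(V_0,\ldots,V_{k-1},E)$ is a graph together with an ordered partition $(V_0,\ldots,V_{k-1})$ of its vertex set into $k$ non-empty parts (levels) such that every edge joins vertices in different parts. $N(x)$ is the neighbourhood of $x$. Factorisation. Given a $k$-partite graph $G=(V_0,\ldots,V_{k-1},E)$ with $k\ge 2$ and a set $V'_k$ of subsets of $V(G)$, the factorisation of $G$ with respect to $V'_k$ is the graph $G'=(V_0,\ldots,V_k,E\cup E_+)$, where the new level $V_k$ is the set of inclusion-maximal elements of $V'_k$ and $E_+=\{Xy \mid X\in V_k,\ y\in X\}$. It is called effective if $V_k\neq\emptyset$. Weak-factor graph. For a $k$-partite graph, $V^+_k$ is the set of all sets $\{x_1,\ldots,x_l\}\cup\bigcap_{1\le i\le l}N(x_i)$ where $l\ge 2$, $x_1,\ldots,x_l$ are distinct elements of $V_{k-1}$, and $|\bigcap_{1\le i\le l}N(x_i)|\ge 2$. The weak-factor graph of a $k$-partite graph is its factorisation with respect to $V^+_k$. Weak-factor series of a graph $G$. $\mathcal{K}(G)$ is the set of maximal cliques of $G$. $G_1=B(G)$ is the vertex-clique-incidence bipartite graph: level $V_0=V(G)$, level $V_1=\mathcal{K}(G)$, with an edge $vC$ whenever $v\in C$. For $i\ge 1$, $G_{i+1}$ is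 the weak-factor graph of $G_i$ if that factorisation is effective, and is undefined otherwise. The series terminates if for some $i\geq 1$ the factorisation of $G_i$ is not effective. *)

(* Defs.v *)
From HB Require Import structures.
From mathcomp Require Import all_boot.

Set Implicit Arguments.
Unset Strict Implicit.
Unset Printing Implicit Defensive.

Record sgraph : Type := SGraph {
  vertex :> finType;
  edge : rel vertex;
  edge_sym : symmetric edge;
  edge_irr : irreflexive edge
}.

Definition nbh (G : sgraph) (x : G) : {set G} := [set y | edge x y].

Definition clique (G : sgraph) (A : {set G}) : bool :=
  [forall x in A, forall y in A, (x != y) ==> edge x y].

Definition maximal_sets (T : finType) (S : {set {set T}}) : {set {set T}} :=
  [set X | maxset [in S] X].

Definition max_cliques (G : sgraph) : {set {set G}} :=
  maximal_sets [set A | clique A].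

(* The ordered partition (V_0, ..., V_{k-1}) is given by its index map:
   V_i is the fibre of [level] over i. *)
Record kpartite (k : nat) : Type := KPartite {
  kgraph :> sgraph;
  level : kgraph -> 'I_k;
  level_edge : forall x y : kgraph, edge x y -> level x != level y;
  level_nonempty : forall i : 'I_k, exists x : kgraph, level x = i
}.

(* Adding the members of S, a family of sets of vertices, as new vertices:
   the new vertex X is joined to the old vertices that it contains. *)
Section Adjoin.
Variables (T : finType) (S : {set {set T}}).

Definition adjoined : finType := (T + {X : {set T} | X \in S})%type.

Definition adjoin_edge (e : rel T) : rel adjoined := fun x y =>
  match x, y with
  | inl u, inl v => e u v
  | inl u, inr X => u \in val X
  | inr X, inl v => v \in val X
  | inr _, inr _ => false
  end.

Definition adjoin_level (k : nat) (l : T -> 'I_k) (x : adjoined) : 'I_k.+1 :=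
  match x with
  | inl u => widen_ord (leqnSn k) (l u)
  | inr _ => ord_max
  end.

Lemma adjoin_edge_sym (e : rel T) : symmetric e -> symmetric (adjoin_edge e).
Proof. by move=> se [u|X] [v|Y] //=; apply: se. Qed.

Lemma adjoin_edge_irr (e : rel T) :
  irreflexive e -> irreflexive (adjoin_edge e).
Proof. by move=> ie [u|X] //=; apply: ie. Qed.

Lemma adjoin_level_edge (k : nat) (e : rel T) (l : T -> 'I_k) :
  (forall u v, e u v -> l u != l v) ->
  forall x y, adjoin_edge e x y -> adjoin_level l x != adjoin_level l y.
Proof.
move=> le [u|X] [v|Y] //= => [/le|_|_]; rewrite -!(inj_eq val_inj) //=.
  by rewrite neq_ltn ltn_ord.
by rewrite neq_ltn ltn_ord orbT.
Qed.

Lemma adjoin_level_nonempty (k : nat) (l : T -> 'I_k) :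
  (forall i, exists u, l u = i) -> S != set0 ->
  forall i, exists x, adjoin_level l x = i.
Proof.
move=> ne /set0Pn[X XS] i; have [ik|ki] := ltnP i k.
  by have [u lu] := ne (Ordinal ik); exists (inl u); apply/val_inj; rewrite /= lu.
exists (inr (exist _ X XS)); apply/val_inj/eqP.
by rewrite /= eqn_leq ki -ltnS ltn_ord.
Qed.

End Adjoin.

Section Factorisation.
Variables (k : nat) (G : kpartite k.+2) (S : {set {set G}}).

Definition effective : bool := maximal_sets S != set0.

(* Only an effective factorisation has all its levels non-empty, i.e. is a
   (k+3)-partite graph, so effectiveness is a hypothesis here. *)
Definition factorisation (eff : effective) : kpartite k.+3 :=
  @KPartite k.+3
    (SGraph (@adjoin_edge_sym _ (maximal_sets S) _ (@edge_sym G))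
            (@adjoin_edge_irr _ (maximal_sets S) _ (@edge_irr G)))
    (@adjoin_level _ (maximal_sets S) _ (@level _ G))
    (@adjoin_level_edge _ (maximal_sets S) _ _ _ (@level_edge _ G))
    (@adjoin_level_nonempty _ (maximal_sets S) _ _ (@level_nonempty _ G) eff).

End Factorisation.

(* A is the set {x_1, ..., x_l} of pairwise distinct vertices of the last
   level. *)
Definition weak_sets (k : nat) (G : kpartite k.+2) : {set {set G}} :=
  [set A :|: \bigcap_(x in A) nbh x | A : {set G} &
     [&& A \subset [set x : G | level x == ord_max], 2 <= #|A|
       & 2 <= #|\bigcap_(x in A) nbh x|]].

Definition weak_effective (k : nat) (G : kpartite k.+2) : bool :=
  effective (weak_sets G).

Definition weak_factor (k : nat) (G : kpartite k.+2) :
    option (kpartite k.+3) :=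
  match @idP (weak_effective G) with
  | ReflectT eff => Some (factorisation eff)
  | ReflectF _ => None
  end.

Section Incidence.
Variables (G : sgraph) (G_gt0 : 0 < #|G|).

Lemma max_cliques_neq0 : max_cliques G != set0.
Proof.
have cl0 : [in [set A : {set G} | clique A]] set0.
  by rewrite /= inE; apply/forall_inP => x; rewrite inE.
have [B maxB _] := maxset_exists cl0.
by apply/set0Pn; exists B; rewrite inE.
Qed.

Lemma level0_nonempty (i : 'I_1) : exists x : G, (fun=> ord0) x = i.
Proof. by have /card_gt0P[x _] := G_gt0; exists x; rewrite ord1. Qed.

(* The levels of B(G) are non-empty only when G has a vertex. *)
Definition incidence : kpartite 2 :=
  @KPartite 2
    (SGraph (@adjoin_edge_sym _ (max_cliques G) (fun _ _ => false)
               (fun _ _ => erefl))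
            (@adjoin_edge_irr _ (max_cliques G) (fun _ _ => false)
               (fun=> erefl)))
    (@adjoin_level _ (max_cliques G) 1 (fun=> ord0))
    (@adjoin_level_edge _ (max_cliques G) 1 (fun _ _ => false) (fun=> ord0)
       (fun _ _ => fun h : false => False_ind _ (notF h)))
    (@adjoin_level_nonempty _ (max_cliques G) 1 (fun=> ord0)
       level0_nonempty max_cliques_neq0).

(* [weak_factor_series i] is G_{i+1}, which has i + 2 levels; [None] means
   that G_{i+1} is undefined. *)
Fixpoint weak_factor_series (i : nat) : option (kpartite i.+2) :=
  match i with
  | 0 => Some incidence
  | j.+1 => obind (@weak_factor j) (weak_factor_series j)
  end.

Definition terminates : Prop :=
  exists (i : nat) (H : kpartite i.+2),
    weak_factor_series i = Some H /\ ~~ weak_effective H.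

End Incidence.

(* Main.v *)
Require Import Defs.
From mathcomp Require Import all_boot zify.

Set Implicit Arguments.
Unset Strict Implicit.
Unset Printing Implicit Defensive.

(** Non-termination is witnessed by three vertices [a], [b], [c] of the last
    level that have two common neighbours, while [u] is adjacent to [a] and [c]
    but not to [b], and [v] to [b] and [c] but not to [a]. Maximal weak sets
    containing [{a, c}], [{b, c}] and [{a, b, c}] are three such vertices of the
    next level: the common neighbours are kept, and [a] and [b] take the roles
    of [u] and [v]. The configuration occurs in [B(G)] for [G] the join of a
    4-cycle and an edge. *)

Definition top (k : nat) (G : kpartite k.+1) : {set G} :=
  [set x | level x == ord_max].

Variant nonterminating_pattern (k : nat) (G : kpartite k.+1) : Prop :=
  NonterminatingPattern (a b c u v w z : G) of
      a \in top G & b \in top G & c \in top G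
    & edge a u & edge c u & ~~ edge b u
    & edge b v & edge c v & ~~ edge a v
    & w != z & {subset [:: w; z] <= nbh a}
    & {subset [:: w; z] <= nbh b} & {subset [:: w; z] <= nbh c}.

Lemma edge_top (k : nat) (G : kpartite k.+1) (x y : G) :
  x \in top G -> edge x y -> y \notin top G.
Proof. by rewrite !inE => /eqP xt /level_edge; rewrite xt eq_sym. Qed.

Section MaximalWeakSets.
Variables (k : nat) (G : kpartite k.+2).

(** No edge joins two top vertices, so the top vertices of a weak set are exactly its generators and
    the remaining ones are their common neighbours. Membership in a weak set thus forces adjacency,
    which is how vertices get excluded from one. *)
Lemma weak_set_edge (X : {set G}) (x y : G) :
  X \in weak_sets G -> x \in X -> y \in X -> x \in top G -> y \notin top G ->
  edge x y.
Proof.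
case/imsetP => A; rewrite inE => /and3P[/subsetP Atop A2 _] -> xX yX xt yt.
have yI : y \in \bigcap_(a in A) nbh a.
  by case/setUP: yX => // /Atop; rewrite (negbTE yt).
have xA : x \in A.
  case/setUP: xX => // /bigcapP xI.
  have /card_gt0P[a aA] : 0 < #|A| by apply: leq_trans A2.
  have := xI a aA; rewrite inE => /(edge_top (Atop a aA)).
  by rewrite xt.
by have /bigcapP/(_ x xA) := yI; rewrite inE.
Qed.

(** The distinct [w] and [z] give the two common neighbours that a weak set requires. A maximal set
    above the one generated by [A] may have further generators, so only lower bounds on its members
    are recorded. *)
Lemma maximal_weak_set (A : {set G}) (w z : G) :
  A \subset top G -> 2 <= #|A| -> w != z ->
  {in A, forall x, {subset [:: w; z] <= nbh x}} ->
  exists2 X : {set G}, X \in maximal_sets (weak_sets G) &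
    {subset A <= X} /\ forall y, {in A, forall x, edge x y} -> y \in X.
Proof.
move=> Atop A2 wz wzA.
have wS : [in weak_sets G] (A :|: \bigcap_(x in A) nbh x).
  apply: imset_f; rewrite inE Atop A2 /=.
  apply: (@leq_trans #|[set w; z]|); first by rewrite cards2 wz.
  apply/subset_leq_card/subsetP => y yw; apply/bigcapP => x /wzA; apply.
  by rewrite !inE in yw *.
have [X maxX sX] := maxset_exists wS.
exists X; first by rewrite inE.
split=> [x xA|y Ay]; apply: (subsetP sX); rewrite inE ?xA //.
by apply/orP; right; apply/bigcapP => x /Ay; rewrite inE.
Qed.

Lemma nonterminating_pattern_step :
  nonterminating_pattern G ->
  weak_effective G /\
  exists2 H, weak_factor G = Some H & nonterminating_pattern H.
Proof.
case=> a b c u v w z ta tb tc au cu bu bv cv av wz wza wzb wzc.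
have ac : a != c by apply: contraNneq av => ->.
have bc : b != c by apply: contraNneq bu => ->.
(* Lying below the top level makes [u] and [v] eligible for [weak_set_edge]. *)
have ut := edge_top ta au; have vt := edge_top tb bv.
have [||//||X mX [sX iX]] := @maximal_weak_set [set a; c] w z.
- by rewrite subUset !sub1set ta.
- by rewrite cards2 ac.
- by move=> x /set2P[]->.
have [||//||Y mY [sY iY]] := @maximal_weak_set [set b; c] w z.
- by rewrite subUset !sub1set tb.
- by rewrite cards2 bc.
- by move=> x /set2P[]->.
have [||//||Z mZ [sZ iZ]] := @maximal_weak_set [set a; b; c] w z.
- by rewrite !subUset !sub1set ta tb.
- apply: (@leq_trans #|[set a; c]|); first by rewrite cards2 ac.
  by rewrite subset_leq_card // setUAC subsetUl.
- by move=> x; rewrite !inE => /orP[/orP[]|] /eqP->.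
have weakX : X \in weak_sets G by move: mX; rewrite inE => /maxsetp.
have weakY : Y \in weak_sets G by move: mY; rewrite inE => /maxsetp.
have uX : u \in X by apply: iX => x /set2P[]->.
have vY : v \in Y by apply: iY => x /set2P[]->.
(* However far [X] extends the generators [a] and [c], it contains [u], so [b] in [X] would be
   adjacent to [u]. The same holds for [a], [Y] and [v]. *)
have bX : b \notin X.
  by apply: contra bu => bX; apply: (weak_set_edge weakX).
have aY : a \notin Y.
  by apply: contra av => aY; apply: (weak_set_edge weakY).
have eff : weak_effective G by apply/set0Pn; exists X.
(* The factorisation depends on the proof [e] obtained from [idP], so [H] is built from [e] rather
   than [eff]. *)
split=> //; rewrite /weak_factor; case: {-}_ / idP => [e|//].
exists (factorisation e) => //.
pose H := factorisation e.
pose old (x : G) : H := inl x.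
pose new (V : {set G}) (mV : V \in maximal_sets (weak_sets G)) : H :=
  inr (exist _ V mV).
have wzI : {in [:: w; z], forall y, [/\ edge a y, edge b y & edge c y]}.
  by move=> y yw; move: (wza y yw) (wzb y yw) (wzc y yw); rewrite !inE.
have wzXYZ : {in [:: w; z], forall y, [/\ y \in X, y \in Y & y \in Z]}.
  move=> y /wzI[ya yb yc]; split; [apply: iX|apply: iY|apply: iZ] => x.
  - by case/set2P=> ->.
  - by case/set2P=> ->.
  - by rewrite !inE => /orP[/orP[]|]/eqP->.
have subn (V : {set G}) mV : {in [:: w; z], forall y, y \in V} ->
    {subset [:: old w; old z] <= nbh (@new V mV)}.
  move=> wzV x; rewrite !inE => /orP[]/eqP->; apply: wzV;
  by rewrite !inE eqxx ?orbT.
apply: (@NonterminatingPattern _ H (new X mX) (new Y mY) (new Z mZ)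
          (old a) (old b) (old w) (old z)) => //=.
- by rewrite inE.
- by rewrite inE.
- by rewrite inE.
- by apply: sX; rewrite set21.
- by apply: sZ; rewrite !inE eqxx.
- by apply: sY; rewrite set21.
- by apply: sZ; rewrite !inE eqxx orbT.
- by apply: subn => y /wzXYZ[].
- by apply: subn => y /wzXYZ[].
- by apply: subn => y /wzXYZ[].
Qed.

End MaximalWeakSets.

(* The 4-cycle is on 0, 1, 2, 3 and the edge joins 4 and 5. *)
Definition cycle_join_edge (x y : 'I_6) : bool :=
  (x != y) && ((maxn x y < 4) ==> odd (x + y)).

Lemma cycle_join_sym : symmetric cycle_join_edge.
Proof. by move=> x y; rewrite /cycle_join_edge eq_sym maxnC addnC. Qed.

Lemma cycle_join_irr : irreflexive cycle_join_edge.
Proof. by move=> x; rewrite /cycle_join_edge eqxx. Qed.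

Definition cycle_join : sgraph := SGraph cycle_join_sym cycle_join_irr.

Lemma cycle_join_max_clique (i : nat) :
  exists2 C : {set cycle_join}, C \in max_cliques cycle_join &
    forall x : 'I_6, (3 < x) || (i <= x <= i.+1) -> x \in C.
Proof.
pose K : {set cycle_join} := [set x : 'I_6 | (3 < x) || (i <= x <= i.+1)].
have clK : [in [set A : {set cycle_join} | clique A]] K.
  rewrite /= inE; apply/forall_inP => x xK; apply/forall_inP => y yK.
  apply/implyP => xy; rewrite /= /cycle_join_edge xy /=; apply/implyP.
  (* Two distinct members below 4 are [i] and [i.+1], whose sum is odd. *)
  move: xK yK xy; rewrite !inE -(inj_eq val_inj) /=; lia.
have [C maxC sC] := maxset_exists clK.
exists C; first by rewrite inE.
by move=> x Kx; apply: (subsetP sC); rewrite inE.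
Qed.

Lemma cycle_join_gt0 : 0 < #|cycle_join|.
Proof. by rewrite card_ord. Qed.

(** [A], [C], [B] extend the consecutive cycle edges 01, 12, 23, each joined with 4 and 5. Opposite
    vertices of the cycle are not adjacent: 3 in [B] excludes 1, and 0 in [A] excludes 2. *)
Lemma incidence_pattern : nonterminating_pattern (incidence cycle_join_gt0).
Proof.
have [A mA sA] := cycle_join_max_clique 0.
have [C mC sC] := cycle_join_max_clique 1.
have [B mB sB] := cycle_join_max_clique 2.
have nonadj (D : {set cycle_join}) (x y : 'I_6) : D \in max_cliques cycle_join ->
    y \in D -> x != y -> ~~ cycle_join_edge x y -> x \notin D.
  rewrite inE => /maxsetp; rewrite /= inE => /forall_inP clD yD xy.
  apply: contra => xD; have /forall_inP/(_ y yD)/implyP := clD x xD.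
  exact.
pose H := incidence cycle_join_gt0.
pose vert (n : nat) : H := inl (inord n : 'I_6).
pose new (D : {set cycle_join}) (mD : D \in max_cliques cycle_join) : H :=
  inr (exist _ D mD).
have subn (D : {set cycle_join}) mD : (forall x : 'I_6, 3 < x -> x \in D) ->
    {subset [:: vert 4; vert 5] <= nbh (@new D mD)}.
  by move=> sD x; rewrite !inE => /orP[]/eqP->; apply: sD; rewrite inordK.
apply: (@NonterminatingPattern _ H (new A mA) (new B mB) (new C mC)
          (vert 1) (vert 2) (vert 4) (vert 5)) => //=.
- by rewrite inE.
- by rewrite inE.
- by rewrite inE.
- by apply: sA; rewrite inordK.
- by apply: sC; rewrite inordK.
- apply: (nonadj _ _ (inord 3)) => //; first by apply: sB; rewrite inordK.
    by rewrite -(inj_eq val_inj) /= !inordK.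
  by rewrite /cycle_join_edge !inordK // andbF.
- by apply: sB; rewrite inordK.
- by apply: sC; rewrite inordK.
- apply: (nonadj _ _ (inord 0)) => //; first by apply: sA; rewrite inordK.
    by rewrite -(inj_eq val_inj) /= !inordK.
  by rewrite /cycle_join_edge !inordK // andbF.
- by rewrite (inj_eq (@inl_inj _ _)) -(inj_eq val_inj) /= !inordK.
- by apply: subn => x x3; apply: sA; rewrite x3.
- by apply: subn => x x3; apply: sB; rewrite x3.
- by apply: subn => x x3; apply: sC; rewrite x3.
Qed.

(** The pattern is the induction invariant: it makes the next graph defined and passes on to it. *)
Lemma series_pattern (i : nat) :
  exists2 H, weak_factor_series cycle_join_gt0 i = Some H
             & nonterminating_pattern H.
Proof.
elim: i => [|i [H /= -> /nonterminating_pattern_step[_ //]]].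
by exists (incidence cycle_join_gt0) => //; apply: incidence_pattern.
Qed.

Theorem mainTheorem4 :
  exists (G : sgraph) (G_gt0 : 0 < #|G|),
    ~ terminates G_gt0 /\
    forall i : nat, exists H : kpartite i.+2,
      weak_factor_series G_gt0 i = Some H /\ weak_effective H.
Proof.
exists cycle_join, cycle_join_gt0; split=> [[i [H [defH /negP[]]]]|i].
  have [H'] := series_pattern i; rewrite defH => -[<-].
  by case/nonterminating_pattern_step.
have [H defH /nonterminating_pattern_step[effH _]] := series_pattern i.
by exists H.
Qed.
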